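(* Let $L\ge1$ and consider the continuous-time reverse sampling process of a masked diffusion model with noise schedule $\alpha$, started at time $t=1$ from the fully masked sequence of length $L$. Put $\tau_L=1$ and, for $1\le n\le L$, let $\tau_{n-1}$ be the time at which the number of masked tokens drops from $n$ to $n-1$ (time runs downwards from $1$ to $0$). Then for each $1\le n\le L$, given that there are $n$ masked tokens remaining and that the last unmasking happened at time $\tau_n$ (more precisely, conditionally on $\tau_L,\tau_{L-1},\dots,\tau_n$), the next unmasking time $\tau_{n-1}$ has the same distribution as $$\alpha^{-1}\big(1-u_n^{1/n}(1-\alpha_{\tau_n})\big),$$ where $u_n\sim\mathcal U(0,1)$ is uniform on $[0,1]$ and independent of $\tau_L,\dots,\tau_n$.
   Context: The noise schedule $\alpha:[0,1]\to[0,1]$, $t\mapsto\alpha_t$, is a continuous strictly decreasing function with $\alpha_0=1$, $\alpha_1=0$, and $\alpha^{-1}$ denotes its inverse function. In a masked diffusion model, tokens take values in $\{0,\dots,m-1,m\}$ with $m$ the mask token. A reverse sampling step from time $t$ to $s<t$ acts on a sequence $\mathbf x_t$ of length $L$ as follows: unmasked tokens are left unchanged and, independently over the positions $l$ with $x_t^{(l)}=m$, $x_s^{(l)}$ is drawn from the categorical distribution with probability vector $\frac{(1-\alpha_s)\mathbf e_m+(\alpha_s-\alpha_t)\boldsymbol\mu^{(l)}_\theta(\mathbf x_t,t)}{1-\alpha_t}$, where $\mathbf e_m$ is the one-hot vector of $m$ and $\boldsymbol\mu^{(l)}_\theta(\mathbf x_t,t)$ is a probability vector giving zero mass to $m$.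 The continuous-time reverse sampling process is the Markov jump process obtained when the step sizes tend to $0$. In it, whether a token is unmasked does not depend on the network $\boldsymbol\mu_\theta$: writing $M_t\subseteq\{1,\dots,L\}$ for the set of masked positions at time $t$, the process $(M_t)$, run from $t=1$ down to $t=0$, is a Markov process with $M_1=\{1,\dots,L\}$ and $M_s\subseteq M_t$ for $s<t$, such that for $0\le s<t\le1$, given the history of the process on $[t,1]$, each $l\in M_t$ belongs to $M_s$ with probability $\frac{1-\alpha_s}{1-\alpha_t}$, independently over $l\in M_t$. For $1\le n\le L$, $\tau_{n-1}=\sup\{t\in[0,1]:|M_t|\le n-1\}$ (almost surely, no two tokens are unmasked at the same time). *)

(* Defs.v *)
From HB Require Import structures.
From mathcomp Require Import all_boot all_order all_algebra.
From mathcomp Require Import all_classical all_reals all_analysis.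

Set Implicit Arguments.
Unset Strict Implicit.
Unset Printing Implicit Defensive.

Import Order.TTheory GRing.Theory Num.Theory.
Import numFieldNormedType.Exports.

Local Open Scope classical_set_scope.
Local Open Scope ring_scope.

Section Conditioning.
Context (R : realType) (d : measure_display) (T : measurableType d).
Variable P : probability T R.

(* [f] is a version of the conditional probability of the event [E] given the
   sub-sigma-algebra [G]; such an [f] is unique up to a [P]-null set. *)
Definition is_cond_prob (G : set (set T)) (E : set T) (f : T -> R) : Prop :=
  [/\ forall B : set R, measurable B -> G (f @^-1` B),
      P.-integrable [set: T] (EFin \o f)
    & forall H, G H -> (\int[P]_(w in H) (f w)%:E = P (H `&` E))%E].

(* [kappa] is a regular version of the conditional distribution of [X] given
   [G], [kappa w] being a distribution on R for every outcome [w]. *)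
Definition has_cond_law (G : set (set T)) (X : T -> R)
    (kappa : T -> set R -> \bar R) : Prop :=
  forall B : set R, measurable B ->
    is_cond_prob G (X @^-1` B) (fun w => fine (kappa w B)).

Definition same_cond_law (G : set (set T)) (X Y : T -> R) : Prop :=
  exists kappa : T -> probability R R,
    has_cond_law G X (fun w => kappa w) /\ has_cond_law G Y (fun w => kappa w).

Definition indep_of (G : set (set T)) (X : T -> R) : Prop :=
  forall H B, G H -> measurable B ->
    (P (H `&` X @^-1` B) = P H * P (X @^-1` B))%E.

End Conditioning.

(* The values of [alpha] outside [0, 1] are irrelevant. *)
Definition noise_schedule (R : realType) (alpha : R -> R) : Prop :=
  [/\ {within `[0, 1]%classic, continuous alpha},
      forall s t, 0 <= s -> s < t -> t <= 1 -> alpha t < alpha s,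
      alpha 0 = 1
    & alpha 1 = 0].

(* The inverse function of [alpha : [0, 1] -> [0, 1]], extended by 0 outside
   the image [0, 1]. *)
Definition schedule_inv (R : realType) (alpha : R -> R) : R -> R :=
  'pinv_(fun=> 0) `[0, 1]%classic alpha.

Section MaskedProcess.
Context (R : realType) (d : measure_display) (T : measurableType d) (L : nat).
Implicit Types M : R -> T -> {set 'I_L}.

(* [M t w] is the set of masked positions at time [t]; time runs downwards from
   1 to 0, so the history at time [t] consists of the [M r] with
   [t <= r <= 1]. *)
Definition history M (t : R) : set (set T) :=
  <<s [set E | exists r A, t <= r <= 1 /\ E = [set w | M r w = A]] >>.

(* Probability that a random subset of [A], containing each element of [A]
   independently with probability [p], is equal to [B]. *)
Definition thinning_prob (p : R) (A B : {set 'I_L}) : R :=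
  if B \subset A then \prod_(l in A) (if l \in B then p else 1 - p) else 0.

Definition reverse_masking_process (P : probability T R) (alpha : R -> R) M
    : Prop :=
  [/\ forall t (A : {set 'I_L}), 0 <= t <= 1 -> measurable [set w | M t w = A],
      forall w, M 1 w = [set: 'I_L]%SET,
      forall s t w, 0 <= s -> s < t -> t <= 1 -> M s w \subset M t w
    & forall s t (B : {set 'I_L}), 0 <= s -> s < t -> t <= 1 ->
        is_cond_prob P (history M t) [set w | M s w = B]
          (fun w => thinning_prob ((1 - alpha s) / (1 - alpha t)) (M t w) B)].

Definition unmasking_time M (k : nat) (w : T) : R :=
  if (k < L)%N then sup [set t | 0 <= t <= 1 /\ (#|M t w| <= k)%N] else 1.

(* The sigma-algebra generated by the unmasking times of indices L, ..., n. *)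
Definition unmasking_history M (n : nat) : set (set T) :=
  <<s [set E | exists k (B : set R),
         [/\ (n <= k <= L)%N, measurable B & E = unmasking_time M k @^-1` B]] >>.

End MaskedProcess.

(* The value of the next unmasking time when [n] tokens are masked, the last
   unmasking happened at time [t], and the uniform variable takes value [v]. *)
Definition next_time (R : realType) (alpha : R -> R) (n : nat) (t v : R) : R :=
  schedule_inv alpha (1 - v `^ (n%:R^-1) * (1 - alpha t)).

(* Main.v *)
(** Fix [s] and write [F t = 1 - alpha t].  Given the history up to time [a > s]
    with [n] tokens still masked at time [a], all of them are still masked at
    time [s] with probability [(F s / F a) ^ n].  Cutting [(s, 1]] into pieces
    [(a, b]] on which [F] grows by the same small amount and using this on the
    events [a < tau_n <= b], which are compatible with the history at time [a],
    gives [(F s / F tau_n) ^ n] for the conditional probability that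
    [tau_(n-1) <= s], up to an error of first order in the mesh; the only
    obstruction, two unmaskings in the same piece, has probability of second
    order for each piece.  As a function of [s] this is the distribution
    function of [alpha^-1 (1 - U ^ (1/n) * F tau_n)] for a uniform [U], and the
    law of the pair ([tau_n], independent uniform) is a product measure. *)

Require Import Defs.
From HB Require Import structures.
From mathcomp Require Import all_boot all_order all_algebra.
From mathcomp Require Import all_classical all_reals all_analysis.
From mathcomp Require Import measurable_realfun ring lra.

Set Implicit Arguments.
Unset Strict Implicit.
Unset Printing Implicit Defensive.

Import Order.TTheory GRing.Theory Num.Theory.
Import numFieldNormedType.Exports.

Local Open Scope classical_set_scope.
Local Open Scope ring_scope.

(** * Noise schedules and the next unmasking time *)

Section NoiseSchedule.
Context (R : realType) (alpha : R -> R).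
Hypothesis halpha : noise_schedule alpha.
Implicit Types s t v x y : R.

Lemma schedule0 : alpha 0 = 1. Proof. by case: halpha. Qed.

Lemma schedule1 : alpha 1 = 0. Proof. by case: halpha. Qed.

Lemma schedule_lt s t : 0 <= s <= 1 -> 0 <= t <= 1 ->
  (alpha t < alpha s) = (s < t).
Proof.
case: (halpha) => _ dec _ _ /andP[s0 s1] /andP[t0 t1].
case: (ltgtP s t) => [st|ts|->]; last by rewrite ltxx.
  exact: dec.
by apply/negbTE; rewrite -leNgt ltW// dec.
Qed.

Lemma schedule_le s t : 0 <= s <= 1 -> 0 <= t <= 1 ->
  (alpha t <= alpha s) = (s <= t).
Proof. by move=> hs ht; rewrite !leNgt schedule_lt. Qed.

Lemma schedule_itv t : 0 <= t <= 1 -> 0 <= alpha t <= 1.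
Proof.
move=> /[dup] ht /andP[t0 t1].
have h0 : 0 <= (0 : R) <= 1 by lra.
have h1 : 0 <= (1 : R) <= 1 by lra.
rewrite -schedule0 -{1}schedule1 !schedule_le//.
by rewrite t0 t1.
Qed.

Lemma schedule_inj : {in `[0, 1]%classic &, injective alpha}.
Proof.
move=> s t; rewrite !inE/= !in_itv/= => hs ht st.
by apply/eqP; rewrite eq_le -(schedule_le hs ht) -(schedule_le ht hs) st lexx.
Qed.

Lemma schedule_surj y : 0 <= y <= 1 -> exists2 t, 0 <= t <= 1 & alpha t = y.
Proof.
case: (halpha) => cont _ _ _ hy.
have [|t] := @IVT _ alpha 0 1 y ler01 cont; last by rewrite in_itv/=; exists t.
by rewrite schedule0 schedule1 (min_idPr _) ?(max_idPl _).
Qed.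

Lemma schedule_invK t : 0 <= t <= 1 -> schedule_inv alpha (alpha t) = t.
Proof.
move=> ht; rewrite /schedule_inv pinvKV//; first exact: schedule_inj.
by rewrite inE/= in_itv.
Qed.

Lemma schedule_invKd y : 0 <= y <= 1 ->
  0 <= schedule_inv alpha y <= 1 /\ alpha (schedule_inv alpha y) = y.
Proof. by case/schedule_surj => t ht <-; rewrite schedule_invK. Qed.

Lemma schedule_inv_out y : ~~ (0 <= y <= 1) -> schedule_inv alpha y = 0.
Proof.
move=> hy; rewrite /schedule_inv /pinv_ splitV.
rewrite [X in odflt _ X](_ : _ =
  if pselect ((alpha @` `[0, 1]%classic) y) is left By
  then some (projT1 (cid2 By)) else None)//.
case: pselect => // -[t ht ty]; exfalso; move/negP: hy; apply.
by rewrite -ty; apply: schedule_itv; move: ht; rewrite /= in_itv.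
Qed.

Lemma schedule_inv_itv y : 0 <= schedule_inv alpha y <= 1.
Proof.
have [/schedule_invKd[]//|/schedule_inv_out ->] := boolP (0 <= y <= 1).
by rewrite lexx ler01.
Qed.

(** Open upper rays generate the Borel sets. As [alpha] decreases and the default value is 0, the
    preimage of the ray above [c] is the interval from 0 (included) to [alpha c] (excluded) when
    [0 <= c < 1], and is everything or empty otherwise. *)
Lemma measurable_schedule_inv : measurable_fun setT (schedule_inv alpha).
Proof.
apply: (measurability _ (RGenOInfty.measurableE R)) => _ [_ [c ->] <-].
rewrite setTI.
have [c0|c0] := ltP c 0.
  rewrite (_ : _ @^-1` _ = setT)//; apply/seteqP; split => y //= _.
  by rewrite in_itv/= andbT; case/andP: (schedule_inv_itv y); lra.
have [c1|c1] := ltP c 1; last first.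
  rewrite (_ : _ @^-1` _ = set0)//; apply/seteqP; split => y //=.
  by rewrite in_itv/= andbT; case/andP: (schedule_inv_itv y); lra.
rewrite (_ : _ @^-1` _ = `[0, alpha c[%classic); first exact: measurable_itv.
have hc : 0 <= c <= 1 by rewrite c0 ltW.
have ac := schedule_itv hc.
apply/seteqP; split => y /=; rewrite !in_itv/= ?andbT.
  have [hy|/schedule_inv_out->] := boolP (0 <= y <= 1); last by lra.
  have [h1 h2] := schedule_invKd hy.
  by rewrite -(schedule_lt hc h1) h2 => ->; case/andP: hy => ->.
move=> /andP[y0 yc]; have hy : 0 <= y <= 1 by lra.
have [h1 h2] := schedule_invKd hy.
by rewrite -(schedule_lt hc h1) h2.
Qed.

End NoiseSchedule.

Section NextTime.
Context (R : realType) (alpha : R -> R) (n : nat).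
Hypotheses (halpha : noise_schedule alpha) (n0 : (0 < n)%N).
Implicit Types s t v x : R.

Lemma powR_itv_le1 v x : 0 <= v <= 1 -> 0 <= x -> v `^ x <= 1.
Proof.
move=> /andP[v0 v1] x0; rewrite (_ : 1 = 1 `^ x); last by rewrite powR1.
by rewrite ge0_ler_powR// nnegrE ?ler01.
Qed.

Lemma next_time_itv t v : 0 <= next_time alpha n t v <= 1.
Proof. exact: schedule_inv_itv. Qed.

(** Under these bounds the argument of the inverse stays in [0, 1], so the default value is never
    met and the decreasing [alpha] can be applied to both sides. *)
Lemma next_time_le s t v : 0 <= s <= 1 -> 0 <= t <= 1 -> 0 <= v <= 1 ->
  (next_time alpha n t v <= s) =
  (v `^ n%:R^-1 * (1 - alpha t) <= 1 - alpha s).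
Proof.
move=> hs ht hv; rewrite /next_time.
set p := v `^ _; set y := 1 - _.
have /andP[t0 t1] := schedule_itv halpha ht.
have p0 : 0 <= p by exact: powR_ge0.
have p1 : p <= 1 by rewrite powR_itv_le1 ?invr_ge0.
have hy : 0 <= y <= 1.
  rewrite /y subr_ge0 gerBl mulr_ge0 ?subr_ge0// andbT mulr_ile1 ?subr_ge0//.
  by rewrite gerBl.
have [hx yE] := schedule_invKd halpha hy.
by rewrite -(schedule_le halpha hx hs) yE /y; apply/idP/idP; lra.
Qed.

Lemma uniform_prob_le1 (B : set R) x : 0 <= x <= 1 -> measurable B ->
  (forall v, 0 <= v <= 1 -> B v <-> v <= x) ->
  uniform_prob (@ltr01 R) B = x%:E.
Proof.
move=> /andP[x0 x1] mB Bx; rewrite /uniform_prob integral_uniform_pdf.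
have -> : B `&` `[0, 1] = `[0, x]%classic.
  apply/seteqP; split => v /=; rewrite !in_itv/=.
    by move=> [Bv hv]; case/andP: (hv) => -> _; exact/Bx.
  move=> /andP[v0 vx]; have hv : 0 <= v <= 1 by rewrite v0 (le_trans vx).
  by split=> //; exact/Bx.
rewrite (eq_integral (cst 1%E)) => [|v]; last first.
  rewrite inE/= in_itv/= => /andP[v0 vx].
  by rewrite /uniform_pdf v0 (le_trans vx)// subr0 invr1.
rewrite integral_cst//= mul1e lebesgue_measure_itv/= lte_fin.
case: ltP => [_|xle0]; first by rewrite sube0.
by congr _%:E; apply/eqP; rewrite eq_le x0 xle0.
Qed.

(* [alpha] is arbitrary outside [0, 1]; clipping the time argument makes
   [next_time] jointly measurable on the whole plane. *)
Definition clip t : R := Order.max 0 (Order.min t 1).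

Lemma clip_id t : 0 <= t <= 1 -> clip t = t.
Proof.
by rewrite /clip => /andP[t0 t1]; rewrite (min_idPl t1) (max_idPr t0).
Qed.

Lemma clip_itv t : 0 <= clip t <= 1.
Proof. by rewrite /clip le_max lexx ge_max ler01 ge_min lexx orbT. Qed.

Lemma measurable_clip : measurable_fun setT clip.
Proof. by apply: measurable_maxr => //; exact: measurable_minr. Qed.

Lemma measurable_schedule_clip : measurable_fun setT (alpha \o clip).
Proof.
have ma : measurable_fun (`[0, 1]%classic : set R) alpha.
  apply: subspace_continuous_measurable_fun; first exact: measurable_itv.
  by case: halpha.
apply: (measurable_comp _ _ ma); first exact: measurable_itv.
  by move=> _ [t _ <-]/=; rewrite in_itv/=; exact: clip_itv.
exact: measurable_clip.
Qed.

Lemma measurable_next_time :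
  measurable_fun setT (fun z : R * R => next_time alpha n (clip z.1) z.2).
Proof.
apply: (measurableT_comp (measurable_schedule_inv halpha)).
apply: measurable_funB => //; apply: measurable_funM.
  exact: (measurableT_comp (measurable_powR n%:R^-1) measurable_snd).
apply: measurable_funB => //.
exact: (measurableT_comp measurable_schedule_clip measurable_fst).
Qed.

Lemma measurable_next_time_clip t :
  measurable_fun setT (next_time alpha n (clip t)).
Proof.
exact: (measurableT_comp measurable_next_time (pair1_measurable t)).
Qed.

(** The quotient is the probability that one token masked at time [t] is still masked at time [s];
    its power is the one for [n] independent tokens. Separating [t <= s] keeps the vanishing
    denominator at [t = 0] out of the formula. *)
Definition next_time_cdf s t : R :=
  if t <= s then 1 else ((1 - alpha s) / (1 - alpha t)) ^+ n.

Lemma next_time_cdf_itv s t : 0 <= s <= 1 -> 0 <= t <= 1 ->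
  0 <= next_time_cdf s t <= 1.
Proof.
move=> hs ht; rewrite /next_time_cdf; case: (leP t s) => [_|st]/=.
  by rewrite ler01 lexx.
have := schedule_lt halpha hs ht; rewrite st => ast.
have /andP[_ s1] := schedule_itv halpha hs.
have r0 : 0 <= (1 - alpha s) / (1 - alpha t) by rewrite divr_ge0; lra.
by rewrite exprn_ge0// exprn_ile1// ler_pdivrMr; lra.
Qed.

(** Raising [v ^ (1/n) * (1 - alpha t) <= 1 - alpha s] to the power [n] turns it into an upper bound
    on [v], and the uniform probability is that bound. For [t <= s] every [v] in [0, 1]
    qualifies. *)
Lemma uniform_next_time_le s t : 0 <= s <= 1 -> 0 <= t <= 1 ->
  uniform_prob (@ltr01 R) (next_time alpha n t @^-1` `]-oo, s]) =
  (next_time_cdf s t)%:E.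
Proof.
move=> hs ht; apply: uniform_prob_le1; first exact: next_time_cdf_itv.
  rewrite -(clip_id ht) -[X in measurable X]setTI.
  exact: measurable_next_time_clip.
move=> v /[dup] hv /andP[v0 v1] /=; rewrite in_itv/= next_time_le//.
rewrite /next_time_cdf; set p := v `^ _.
have p0 : 0 <= p by exact: powR_ge0.
have p1 : p <= 1 by rewrite powR_itv_le1 ?invr_ge0.
have pn : p ^+ n = v.
  rewrite /p -powR_mulrn// -powRrM mulVf ?powRr1// pnatr_eq0.
  by case: (n) n0.
have := schedule_le halpha ht hs; case: (leP t s) => st ast /=.
  split=> // _; apply: (@le_trans _ _ (1 * (1 - alpha t))).
    by rewrite ler_wpM2r// subr_ge0; case/andP: (schedule_itv halpha ht).
  by rewrite mul1r; lra.
have /andP[_ s1] := schedule_itv halpha hs.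
rewrite -ler_pdivlMr; last by lra.
rewrite -[X in _ <-> X <= _]pn ler_pXn2r ?nnegrE//.
by rewrite divr_ge0; lra.
Qed.

End NextTime.

(** * Paths and histories of the masking process *)

Section GeneratedSigmaAlgebra.
Context (T : pointedType) (G : set (set T)).
Implicit Types A B E : set T.

Lemma generatedT : <<s G >> setT.
Proof. exact: (@measurableT _ (g_sigma_algebraType G)). Qed.

Lemma generatedI A B : <<s G >> A -> <<s G >> B -> <<s G >> (A `&` B).
Proof. exact: (@measurableI _ (g_sigma_algebraType G)). Qed.

Lemma generatedU A B : <<s G >> A -> <<s G >> B -> <<s G >> (A `|` B).
Proof. exact: (@measurableU _ (g_sigma_algebraType G)). Qed.

(** This reduces a claim about traces on [E] of all sets of a generated sigma-algebra to the traces
    of its generators. Complements are handled relative to [E]. *)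
Lemma sigma_algebra_trace (E : set T) : <<s G >> E ->
  sigma_algebra setT [set A | <<s G >> (A `&` E)].
Proof.
move=> GE; split => [|A GA|A GA] /=.
- by rewrite set0I; exact: sigma_algebra0.
- rewrite (_ : _ `&` _ = E `&` ~` (A `&` E)); last first.
    by rewrite setTD setCI setIUr setICr setU0 setIC.
  by apply: generatedI => //; exact: sigma_algebraC.
- by rewrite setI_bigcupl; exact: sigma_algebra_bigcup.
Qed.

Lemma generated_trace (G' : set (set T)) E H : <<s G >> E ->
  (forall K, G' K -> <<s G >> (K `&` E)) -> <<s G' >> H -> <<s G >> (H `&` E).
Proof.
move=> GE GK; move: H; apply: smallest_sub => //.
exact: sigma_algebra_trace.
Qed.

Lemma generated_preimage (R : realType) (f : T -> R) E (B : set R) :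
  <<s G >> E -> (forall c, <<s G >> (f @^-1` `]c, +oo[ `&` E)) ->
  measurable B -> <<s G >> (f @^-1` B `&` E).
Proof.
move=> GE Gf mB.
have : (@RGenOInfty.G R).-sigma.-measurable B.
  by rewrite -RGenOInfty.measurableE.
move: B {mB}; apply: smallest_sub => [|_ [c ->]//].
have [S0 SC SU] := sigma_algebra_trace GE.
split => [|B /SC|F GF] /=; first by rewrite preimage_set0; exact: S0.
  by rewrite !setTD preimage_setC.
by rewrite preimage_bigcup; exact: SU.
Qed.

End GeneratedSigmaAlgebra.

Section Paths.
Context (R : realType) (d : measure_display) (T : measurableType d) (L : nat).
Context (P : probability T R) (alpha : R -> R) (M : R -> T -> {set 'I_L}).
Hypothesis hM : reverse_masking_process P alpha M.
Implicit Types (s t c : R) (w : T) (k n : nat).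

Lemma masked_sub s t w : 0 <= s -> s <= t -> t <= 1 -> M s w \subset M t w.
Proof.
case: hM => _ _ sub _ s0; rewrite le_eqVlt => /predU1P[->//|st] t1.
exact: sub.
Qed.

Lemma masked_card s t w : 0 <= s -> s <= t -> t <= 1 ->
  (#|M s w| <= #|M t w|)%N.
Proof. by move=> s0 st t1; exact/subset_leq_card/masked_sub. Qed.

Lemma masked1 w : M 1 w = [set: 'I_L]%SET. Proof. by case: hM. Qed.

Lemma masked_card1 w : #|M 1 w| = L.
Proof. by rewrite masked1 cardsT card_ord. Qed.

Lemma le_unmasking_time k t w : (k < L)%N -> 0 <= t <= 1 ->
  (#|M t w| <= k)%N -> t <= unmasking_time M k w.
Proof.
move=> kL ht tk; rewrite /unmasking_time kL; apply: ub_le_sup => //.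
by exists 1 => r [/andP[]].
Qed.

(** The supremum need not be attained, hence the strict inequality: it provides a later time with at
    most [k] masked positions, and the count is monotone in time. An empty set has supremum 0, which
    [0 <= t] rules out. *)
Lemma lt_unmasking_time k t w : (k < L)%N -> 0 <= t ->
  t < unmasking_time M k w -> (#|M t w| <= k)%N.
Proof.
move=> kL t0; rewrite /unmasking_time kL.
set S := [set _ | _] => tS.
have [S0|/set0P/negP/negPn/eqP S0] := pselect (S !=set0); last first.
  by move: tS; rewrite S0 sup0; lra.
have [r [/andP[r0 r1] rk] tr] := sup_gt S0 tS.
by apply: leq_trans rk; apply: masked_card => //; exact: ltW.
Qed.

Lemma unmasking_time_itv k w : 0 <= unmasking_time M k w <= 1.
Proof.
rewrite /unmasking_time; case: ifP => kL; last by rewrite ler01 lexx.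
set S := [set _ | _].
have [S0|/set0P/negP/negPn/eqP S0] := pselect (S !=set0); last first.
  by rewrite S0 sup0 lexx ler01.
apply/andP; split; last by apply: ge_sup => // r [/andP[]].
have [r Sr] := S0; have [/andP[r0 r1] _] := Sr.
by apply: (le_trans r0); apply: ub_le_sup => //; exists 1 => u [/andP[]].
Qed.

Lemma unmasking_time_full : unmasking_time M L = cst 1.
Proof. by apply/funext => w; rewrite /unmasking_time ltnn. Qed.

Lemma unmasking_time_homo j k w : (j <= k)%N ->
  unmasking_time M j w <= unmasking_time M k w.
Proof.
move=> jk; have [kL|Lk] := ltnP k L; last first.
  rewrite {2}/unmasking_time ltnNge Lk /=.
  by case/andP: (unmasking_time_itv j w).
rewrite leNgt; apply/negP => kj.
have /andP[k0 _] := unmasking_time_itv k w.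
have /andP[_ j1] := unmasking_time_itv j w.
(* Neither supremum need be attained, so the contradiction is sought strictly between the two. *)
pose t := (unmasking_time M k w + unmasking_time M j w) / 2.
have t0 : 0 <= t by rewrite /t; lra.
have tj : t < unmasking_time M j w by rewrite /t; lra.
have := lt_unmasking_time (leq_ltn_trans jk kL) t0 tj => /leq_trans/(_ jk) tk.
have : t <= unmasking_time M k w by apply: le_unmasking_time => //; lra.
by rewrite /t; lra.
Qed.

Lemma history_pred r t (p : pred {set 'I_L}) : t <= r <= 1 ->
  history M t [set w | p (M r w)].
Proof.
move=> tr; rewrite [X in history _ _ X](_ : _ =
    [set w | M r w \in [seq A <- enum {set 'I_L} | p A]]); last first.
  by apply/seteqP; split => w /=; rewrite mem_filter mem_enum inE andbT.
elim: [seq _ <- _ | _] => [|A s IHs].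
  rewrite (_ : [set _ | _] = set0); first exact: sigma_algebra0.
  by apply/seteqP; split.
rewrite (_ : [set _ | _] = [set w | M r w = A] `|` [set w | M r w \in s]).
  by apply: generatedU => //; apply: sub_sigma_algebra; exists r, A.
apply/seteqP; split => w /=; rewrite inE => /predU1P //.
Qed.

Lemma history_measurable t : 0 <= t -> history M t `<=` measurable.
Proof.
move=> t0; apply: smallest_sub; first exact: sigma_algebra_measurable.
move=> _ [r [A [/andP[tr r1] ->]]]; case: hM => mM _ _ _.
by apply: mM; rewrite r1 (le_trans t0).
Qed.

Lemma measurable_masked t (p : pred {set 'I_L}) : 0 <= t <= 1 ->
  measurable [set w | p (M t w)].
Proof.
move=> /andP[t0 t1]; apply: (history_measurable t0).
by apply: history_pred; rewrite lexx.
Qed.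

(** By monotonicity of paths, some rational time strictly between [c] and the unmasking time already
    has at most [k] masked positions. The event is thus a countable union of events at times above
    [c], hence above [t]. *)
Lemma history_unmasking_time_gt k t c : (k < L)%N -> 0 <= t -> t <= c ->
  history M t [set w | c < unmasking_time M k w].
Proof.
move=> kL t0 tc.
pose F (q : rat) := if c < (ratr q : R) <= 1
  then [set w | (#|M (ratr q) w| <= k)%N] else set0.
have -> : [set w | c < unmasking_time M k w] = \bigcup_q F q.
  apply/seteqP; split => w /=.
    move=> /rat_in_itvoo[q]; rewrite in_itv/= => /andP[cq qk].
    exists q => //; rewrite /F cq /=.
    have /andP[_ k1] := unmasking_time_itv k w.
    rewrite (le_trans (ltW qk))//; apply: lt_unmasking_time => //.
    by rewrite (le_trans t0)// (le_trans tc)// ltW.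
  move=> [q _]; rewrite /F; case: ifP => // /andP[cq q1] /= qk.
  apply: (lt_le_trans cq); apply: le_unmasking_time => //.
  by rewrite q1 andbT (le_trans t0)// (le_trans tc)// ltW.
apply: (@bigcupT_measurable_rat _ (g_sigma_algebraType
  [set E | exists r A, t <= r <= 1 /\ E = [set w | M r w = A]])) => q.
rewrite /F; case: ifP => [/andP[cq q1]|_]; last exact: measurable0.
apply: (@history_pred _ _ (fun A => #|A| <= k)%N).
by rewrite q1 andbT (le_trans tc)// ltW.
Qed.

(** Where the unmasking time of index [n] exceeds [t], so do those of larger index, and all of them
    are determined by the path on [[t, 1]]. This makes the Markov property at time [t] applicable to
    events of the unmasking history. *)
Lemma unmasking_historyI n t H : (n < L)%N -> 0 <= t ->
  unmasking_history M n H ->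
  history M t (H `&` [set w | t < unmasking_time M n w]).
Proof.
move=> nL t0; have hn := history_unmasking_time_gt nL t0 (lexx t).
apply: generated_trace => // _ [k [B [/andP[nk kL] mB ->]]].
apply: generated_preimage => // c.
(* Index [L] stands apart: its unmasking time is the constant 1 and not a supremum. *)
move: kL; rewrite leq_eqVlt => /predU1P[->|kL].
  rewrite unmasking_time_full preimage_cst; case: ifP => _.
    by rewrite setTI.
  by rewrite set0I; exact: sigma_algebra0.
rewrite (_ : _ `&` _ =
    [set w | Order.max c t < unmasking_time M k w] `&`
    [set w | t < unmasking_time M n w]).
  apply: generatedI => //; apply: history_unmasking_time_gt => //.
  by rewrite le_max lexx orbT.
apply/seteqP; split => w /=; rewrite in_itv/= andbT gt_max.
  by move=> [-> tn]; rewrite tn (lt_le_trans tn)//; exact: unmasking_time_homo.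
by move=> [/andP[]].
Qed.

Lemma measurable_unmasking_time k : measurable_fun setT (unmasking_time M k).
Proof.
have [kL|Lk] := ltnP k L; last first.
  rewrite (_ : unmasking_time M k = cst 1)//.
  by apply/funext => w; rewrite /unmasking_time ltnNge Lk.
apply: (measurability _ (RGenOInfty.measurableE R)) => _ [_ [c ->] <-].
rewrite setTI.
have [c0|c0] := leP 0 c.
  rewrite (_ : _ @^-1` _ = [set w | c < unmasking_time M k w]).
    by apply: (history_measurable c0); exact: history_unmasking_time_gt.
  by apply/seteqP; split => w /=; rewrite in_itv/= andbT.
rewrite (_ : _ @^-1` _ = setT)//; apply/seteqP; split => w //= _.
by rewrite in_itv/= andbT; case/andP: (unmasking_time_itv k w); lra.
Qed.

Lemma measurable_unmasking_set k (B : set R) : measurable B ->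
  measurable (unmasking_time M k @^-1` B).
Proof.
move=> mB; rewrite -[X in measurable X]setTI.
exact: measurable_unmasking_time.
Qed.

Lemma unmasking_history_measurable n : unmasking_history M n `<=` measurable.
Proof.
apply: smallest_sub; first exact: sigma_algebra_measurable.
by move=> _ [k [B [_ mB ->]]]; exact: measurable_unmasking_set.
Qed.

End Paths.

(** * Elementary inequalities and real-valued probabilities *)

Lemma le0_of_le_harmonic (R : realType) (x C : R) :
  (forall m : nat, x <= C / m.+1%:R) -> x <= 0.
Proof.
move=> xC; rewrite leNgt; apply/negP => x0.
have C0 : 0 <= C by have := xC 0%N; rewrite divr1; lra.
have := xC (Num.bound (C / x)); apply/negP; rewrite -ltNge.
rewrite ltr_pdivrMr ?ltr0n// mulrC -ltr_pdivrMr//.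
by rewrite (lt_trans (archi_boundP _)) ?ltr_nat// divr_ge0// ltW.
Qed.

Lemma bernoulli_ge (R : realType) (x : R) n : x <= 1 ->
  1 - n%:R * x <= (1 - x) ^+ n.
Proof.
move=> x1; elim: n => [|n IHn]; first by rewrite mul0r subr0 expr0.
have h : (1 - n%:R * x) * (1 - x) <= (1 - x) ^+ n * (1 - x).
  by rewrite ler_wpM2r// subr_ge0.
rewrite exprSr; apply: le_trans h.
have := ler0n R n; rewrite -addn1 natrD; have := sqr_ge0 x; nra.
Qed.

Section RealProbability.
Context (R : realType) (d : measure_display) (T : measurableType d).
Context (P : probability T R).
Implicit Types (A B : set T) (f : T -> R).

(** Real values allow the mesh estimates to subtract and multiply probabilities freely. *)
Definition pr A : R := fine (P A).

Lemma prE A : measurable A -> P A = (pr A)%:E.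
Proof. by move=> mA; rewrite /pr fineK// fin_num_measure. Qed.

Lemma pr_ge0 A : 0 <= pr A. Proof. exact: fine_ge0. Qed.

Lemma pr0 : pr set0 = 0. Proof. by rewrite /pr measure0. Qed.

Lemma le_pr A B : measurable A -> measurable B -> A `<=` B -> pr A <= pr B.
Proof.
by move=> mA mB AB; rewrite -lee_fin -!prE// le_measure// inE.
Qed.

Lemma pr_le1 A : measurable A -> pr A <= 1.
Proof. by move=> mA; rewrite -lee_fin -prE// probability_le1. Qed.

Lemma pr_split A B : measurable A -> measurable B ->
  pr A = pr (A `&` B) + pr (A `&` ~` B).
Proof.
move=> mA mB; apply: EFin_inj; rewrite EFinD -!prE//.
- by rewrite [LHS](measureDI P mA mB) setDE addeC.
- by apply: measurableI => //; exact: measurableC.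
- exact: measurableI.
Qed.

Lemma pr_null A B : measurable A -> measurable B -> A `<=` B -> pr B = 0 ->
  pr A = 0.
Proof.
move=> mA mB AB B0; apply/eqP; rewrite eq_le pr_ge0 andbT -B0.
exact: le_pr.
Qed.

Lemma pr_fin_partition (I : finType) (X : T -> I) A :
  (forall i, measurable [set w | X w = i]) -> measurable A ->
  pr A = \sum_i pr (A `&` [set w | X w = i]).
Proof.
move=> mX mA; apply: EFin_inj; rewrite -prE// -sumEFin.
transitivity (P (\bigcup_(i in [set: I]) (A `&` [set w | X w = i]))).
  congr (P _); rewrite -setI_bigcupr -[LHS]setIT; congr (_ `&` _).
  by apply/seteqP; split => w // _; exists (X w).
rewrite measure_fin_bigcup//=.
- rewrite [RHS](_ : _ = (\sum_(i : I) P (A `&` [set w | X w = i]))%E).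
    rewrite [RHS]bigfs//; first by apply: eq_fsbigl; apply/seteqP; split.
      exact: index_enum_uniq.
    by move=> i _; rewrite mem_index_enum.
  by apply: eq_bigr => i _; rewrite prE//; exact: measurableI.
- apply/trivIsetP => i j _ _ /eqP ij; apply/seteqP.
  by split => w //= [[_ wi] [_ wj]]; apply: ij; rewrite -wi.
- by move=> i _; exact: measurableI.
Qed.

Lemma integrable_itv f A : measurable A -> measurable_fun setT f ->
  (forall w, 0 <= f w <= 1) -> P.-integrable A (EFin \o f).
Proof.
move=> mA mf f01; apply: measurable_bounded_integrable => //.
- by rewrite (le_lt_trans (probability_le1 _ _))// ltry.
- exact: measurable_funTS.
- exists 1; split; first exact: num_real.
  move=> x x1 w _ /=; rewrite ger0_norm; last by case/andP: (f01 w).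
  by rewrite (le_trans _ (ltW x1))//; case/andP: (f01 w).
Qed.

Lemma Rintegral_split f A B : measurable A -> measurable B ->
  measurable_fun setT f -> (forall w, 0 <= f w <= 1) ->
  \int[P]_(w in A) f w =
    \int[P]_(w in A `&` B) f w + \int[P]_(w in A `&` ~` B) f w.
Proof.
move=> mA mB mf f01; rewrite -Rintegral_setU.
- by rewrite -setIUr setUCr setIT.
- exact: measurableI.
- by apply: measurableI => //; exact: measurableC.
- by rewrite -setIUr setUCr setIT; exact: integrable_itv.
- by apply/disj_setPS => w [[_ Bw] [_ /(_ Bw)]].
Qed.

Lemma le_Rintegral_cst f A a : measurable A -> measurable_fun setT f ->
  (forall w, 0 <= f w <= 1) -> (forall w, A w -> f w <= a) ->
  \int[P]_(w in A) f w <= a * pr A.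
Proof.
move=> mA mf f01 fa; rewrite -Rintegral_cst//; apply: le_Rintegral => //.
  exact: integrable_itv.
exact: finite_measure_integrable_cst.
Qed.

Lemma ge_Rintegral_cst f A a : measurable A -> measurable_fun setT f ->
  (forall w, 0 <= f w <= 1) -> (forall w, A w -> a <= f w) ->
  a * pr A <= \int[P]_(w in A) f w.
Proof.
move=> mA mf f01 fa; rewrite -Rintegral_cst//; apply: le_Rintegral => //.
  exact: finite_measure_integrable_cst.
exact: integrable_itv.
Qed.

Lemma EFin_Rintegral f A : measurable A -> measurable_fun setT f ->
  (forall w, 0 <= f w <= 1) ->
  (\int[P]_(w in A) f w)%:E = (\int[P]_(w in A) (f w)%:E)%E.
Proof.
move=> mA mf f01; rewrite fineK//; apply: integrable_fin_num => //.
exact: integrable_itv.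
Qed.

End RealProbability.

(** * The Markov property *)

Section Thinning.
Context (R : realType) (L : nat).
Implicit Types (p : R) (A B : {set 'I_L}).

Lemma thinning_prob_id p A : thinning_prob p A A = p ^+ #|A|.
Proof.
rewrite /thinning_prob subxx (eq_bigr (fun=> p)) => [|l ->//].
by rewrite prodr_const.
Qed.

Lemma thinning_prob_ge0 p A B : 0 <= p <= 1 -> 0 <= thinning_prob p A B.
Proof.
move=> /andP[p0 p1]; rewrite /thinning_prob; case: ifP => // _.
by apply: prodr_ge0 => l _; case: ifP; rewrite ?subr_ge0.
Qed.

(** Each of the at least [j] elements of [A] outside [B] contributes a factor [1 - p], and the
    elements kept contribute factors at most 1. *)
Lemma thinning_prob_le p A B j : 0 <= p <= 1 -> (#|B| + j <= #|A|)%N ->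
  thinning_prob p A B <= (1 - p) ^+ j.
Proof.
move=> /andP[p0 p1] BjA; rewrite /thinning_prob.
case: ifPn => [BA|_]; last first.
  by rewrite exprn_ge0// subr_ge0.
rewrite (bigID (mem B))/=.
apply: (@le_trans _ _ (1 * (1 - p) ^+ #|A :\: B|)).
  apply: ler_pM.
  - by apply: prodr_ge0 => l /andP[_ ->].
  - by apply: prodr_ge0 => l /andP[_ /negbTE ->]; rewrite subr_ge0.
  - apply: (@le_trans _ _ (\prod_(l in A | l \in B) 1)).
      by apply: ler_prod => l /andP[_ ->]; rewrite p0.
    by rewrite big1.
  - rewrite -prodr_const le_eqVlt; apply/orP; left; apply/eqP.
    by apply: eq_big => [l|l /andP[_ /negbTE ->]//]; rewrite inE andbC.
rewrite mul1r; apply: ler_wiXn2l; rewrite ?subr_ge0 ?gerBl//.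
by rewrite cardsD (finset.setIidPr BA) leq_subRL ?subset_leq_card.
Qed.

End Thinning.

Section MarkovStep.
Context (R : realType) (d : measure_display) (T : measurableType d) (L : nat).
Context (P : probability T R) (alpha : R -> R) (M : R -> T -> {set 'I_L}).
Hypothesis halpha : noise_schedule alpha.
Hypothesis hM : reverse_masking_process P alpha M.
Implicit Types (s t c : R) (w : T) (k n j m : nat).

Let keep s t : R := (1 - alpha s) / (1 - alpha t).

Lemma masking_gt0 t : 0 < t <= 1 -> 0 < 1 - alpha t.
Proof.
move=> /andP[t0 t1]; have h0 : 0 <= (0 : R) <= 1 by rewrite lexx ler01.
have ht : 0 <= t <= 1 by rewrite ltW.
by have := schedule_lt halpha h0 ht; rewrite t0 (schedule0 halpha) subr_gt0.
Qed.

Lemma keep_itv s t : 0 <= s -> s <= t -> t <= 1 -> 0 <= keep s t <= 1.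
Proof.
move=> s0 st t1.
have hs : 0 <= s <= 1 by rewrite s0 (le_trans st).
have ht : 0 <= t <= 1 by rewrite t1 (le_trans s0).
have st' : 1 - alpha s <= 1 - alpha t by rewrite lerB// schedule_le.
have /andP[_ s1] := schedule_itv halpha hs.
have /andP[_ t1'] := schedule_itv halpha ht.
apply/andP; split; first by rewrite divr_ge0// subr_ge0.
(* At [t = 0] the denominator vanishes and the quotient is 0, since the inverse of 0 is 0. *)
have [->|t0] := eqVneq t 0.
  by rewrite /keep (schedule0 halpha) subrr invr0 mulr0 ler01.
have t0' : 0 < t by rewrite lt_neqAle eq_sym t0; case/andP: ht.
by rewrite /keep ler_pdivrMr ?mul1r// masking_gt0// t0'.
Qed.

(** The Markov property is integrated over an event of the history on which [M t] is fixed, so the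
    conditional probability is constant there. *)
Lemma pr_masked_step s t H A B : 0 <= s -> s < t -> t <= 1 -> history M t H ->
  pr P (H `&` [set w | M t w = A] `&` [set w | M s w = B]) =
  thinning_prob (keep s t) A B * pr P (H `&` [set w | M t w = A]).
Proof.
move=> s0 st t1 HH; have t0 : 0 <= t by rewrite (le_trans s0)// ltW.
case: (hM) => _ _ _ /(_ s t B s0 st t1)[_ _].
have HA : history M t (H `&` [set w | M t w = A]).
  apply: generatedI => //; apply: sub_sigma_algebra.
  by exists t, A; rewrite lexx.
move/(_ _ HA) => HE; rewrite [LHS]/pr -HE.
have mHA : measurable (H `&` [set w | M t w = A]).
  exact: (history_measurable hM t0).
rewrite -Rintegral_cst//; congr fine; apply: eq_integral => w.
by rewrite inE => -[_ /= ->].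
Qed.

Lemma measurable_masked_set t A : 0 <= t <= 1 -> measurable [set w | M t w = A].
Proof. by case: hM => + _ _ _; exact. Qed.

(** Masked sets are nested, so equal cardinals force equal sets. For each value of [M t] with [n]
    elements the thinning probability is then [keep s t ^+ n], whatever the value, and the sum over
    values factors. *)
Lemma pr_card_stay s t H n : 0 <= s -> s < t -> t <= 1 -> history M t H ->
  pr P (H `&` [set w | #|M t w| = n] `&` [set w | #|M s w| = n]) =
  keep s t ^+ n * pr P (H `&` [set w | #|M t w| = n]).
Proof.
move=> s0 st t1 HH; have t0 : 0 <= t by rewrite (le_trans s0)// ltW.
have ht : 0 <= t <= 1 by rewrite t0.
have hs : 0 <= s <= 1 by rewrite s0 (le_trans (ltW st)).
have mt : measurable [set w | #|M t w| = n].
  rewrite (_ : [set _ | _] = [set w | #|M t w| == n]).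
    exact: (measurable_masked hM (fun A => #|A| == n)).
  by apply/seteqP; split => w /eqP.
have ms : measurable [set w | #|M s w| = n].
  rewrite (_ : [set _ | _] = [set w | #|M s w| == n]).
    exact: (measurable_masked hM (fun A => #|A| == n)).
  by apply/seteqP; split => w /eqP.
have mH : measurable H by exact: (history_measurable hM t0).
have mM A : measurable [set w | M t w = A] by exact: measurable_masked_set.
rewrite (pr_fin_partition P mM); last first.
  by apply: measurableI => //; exact: measurableI.
rewrite [X in _ = _ * X](pr_fin_partition P mM); last exact: measurableI.
rewrite mulr_sumr; apply: eq_bigr => A _.
have [An|An] := eqVneq #|A| n; last first.
  rewrite (_ : _ `&` _ = set0) ?pr0; last first.
    apply/seteqP; split => w //= [[[_ tn] _] wA].
    by move/eqP: An; apply; rewrite -wA.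
  rewrite (_ : _ `&` _ = set0) ?pr0 ?mulr0//.
  apply/seteqP; split => w //= [[_ tn] wA].
  by move/eqP: An; apply; rewrite -wA.
rewrite (_ : _ `&` _ `&` _ `&` _ =
    H `&` [set w | M t w = A] `&` [set w | M s w = A]); last first.
  apply/seteqP; split => w /=.
    move=> [[[Hw tn] sn] tA]; split=> //; apply/eqP.
    by rewrite -tA eqEcard (masked_sub hM w s0 (ltW st) t1) sn tn leqnn.
  by move=> [[Hw tA] sA]; rewrite tA sA An.
rewrite pr_masked_step// thinning_prob_id An; congr (_ * pr P _).
by apply/seteqP; split => w /= => [[Hw tA]|[[]]//]; rewrite tA An.
Qed.

(** At least [j] tokens are lost between [t] and [s]. The constant counts the pairs of values of
    [M t] and [M s], each contributing at most [(1 - keep s t) ^+ j]. The case [j = 1] excludes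
    jumps at a fixed time, and [j = 2] bounds double jumps in a cell. *)
Lemma pr_card_jump s t m j : 0 <= s -> s < t -> t <= 1 ->
  pr P [set w | (m + j <= #|M t w|)%N && (#|M s w| <= m)%N] <=
  (#|{set 'I_L}| * #|{set 'I_L}|)%:R * (1 - keep s t) ^+ j.
Proof.
move=> s0 st t1; have t0 : 0 <= t by rewrite (le_trans s0)// ltW.
have ht : 0 <= t <= 1 by rewrite t0.
have hs : 0 <= s <= 1 by rewrite s0 (le_trans (ltW st)).
have hk := keep_itv s0 (ltW st) t1.
have k0 : 0 <= (1 - keep s t) ^+ j.
  by rewrite exprn_ge0// subr_ge0; case/andP: hk.
set E := [set w | _].
have mE : measurable E.
  rewrite (_ : E = [set w | (m + j <= #|M t w|)%N] `&`
      [set w | (#|M s w| <= m)%N]).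
    apply: measurableI.
      exact: (measurable_masked hM (fun A => m + j <= #|A|)%N).
    exact: (measurable_masked hM (fun A => #|A| <= m)%N).
  by apply/seteqP; split => w /= /andP.
have mM r A : 0 <= r <= 1 -> measurable [set w | M r w = A].
  by move=> hr; exact: measurable_masked_set.
have step A B : pr P (E `&` [set w | M t w = A] `&` [set w | M s w = B]) <=
    (1 - keep s t) ^+ j.
  have mAB : measurable (setT `&` [set w | M t w = A] `&` [set w | M s w = B]).
    by rewrite setTI; apply: measurableI; exact: mM.
  have [/andP[jA Bm]|ABn] := boolP ((m + j <= #|A|) && (#|B| <= m))%N.
    apply: (@le_trans _ _
        (pr P (setT `&` [set w | M t w = A] `&` [set w | M s w = B]))).
      apply: le_pr => //; last by apply: setSI; exact: setSI.
      by apply: measurableI; [apply: measurableI => //|]; exact: mM.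
    rewrite pr_masked_step//; last exact: generatedT.
    apply: (@le_trans _ _ (thinning_prob (keep s t) A B * 1)).
      rewrite ler_wpM2l ?thinning_prob_ge0// pr_le1// setTI; exact: mM.
    rewrite mulr1; apply: thinning_prob_le => //.
    by rewrite (leq_trans _ jA)// leq_add2r.
  rewrite (_ : _ `&` _ `&` _ = set0) ?pr0//.
  apply/seteqP; split => w //= [[/= h tA] sB].
  by move: h; rewrite /E /= tA sB (negbTE ABn).
rewrite (pr_fin_partition P (fun A => mM t A ht))//.
apply: (@le_trans _ _ (\sum_(A : {set 'I_L}) \sum_(B : {set 'I_L})
    (1 - keep s t) ^+ j)).
  apply: ler_sum => A _; rewrite (pr_fin_partition P (fun B => mM s B hs)).
    by apply: ler_sum => B _; exact: step.
  by apply: measurableI => //; exact: mM.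
by rewrite !sumr_const -mulrnA -[leLHS]mulr_natl.
Qed.

End MarkovStep.

Section NextTimeLaw.
Context (R : realType) (alpha : R -> R) (n : nat).
Hypotheses (halpha : noise_schedule alpha) (n0 : (0 < n)%N).
Implicit Types s t v x : R.

(** The sets measured are the sections of one measurable subset of the plane, so their probabilities
    depend measurably on [t]. *)
Lemma measurable_uniform_next_time (B : set R) : measurable B ->
  measurable_fun setT (fun t =>
    uniform_prob (@ltr01 R) (next_time alpha n (clip t) @^-1` B)).
Proof.
move=> mB.
have mA : measurable
    ((fun z : R * R => next_time alpha n (clip z.1) z.2) @^-1` B).
  by rewrite -[X in measurable X]setTI; exact: measurable_next_time.
have := measurable_fun_xsection (uniform_prob (@ltr01 R)) mA.
congr measurable_fun; apply/funext => t /=; congr (uniform_prob _ _).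
by apply/seteqP; split => v; rewrite /xsection /= inE.
Qed.

Lemma measurable_next_time_cdf s : 0 <= s <= 1 ->
  measurable_fun setT (fun t => next_time_cdf alpha n s (clip t)).
Proof.
move=> hs; apply/measurable_EFinP.
rewrite (_ : _ \o _ = fun t =>
  uniform_prob (@ltr01 R) (next_time alpha n (clip t) @^-1` `]-oo, s])).
  exact: measurable_uniform_next_time.
by apply/funext => t /=; rewrite uniform_next_time_le//; exact: clip_itv.
Qed.

Lemma schedule_surj_masking x : 0 <= x <= 1 ->
  exists2 t, 0 <= t <= 1 & 1 - alpha t = x.
Proof.
move=> hx; have hx' : 0 <= 1 - x <= 1 by lra.
have [t ht at'] := schedule_surj halpha hx'.
by exists t => //; rewrite at'; lra.
Qed.

Lemma masking_lt s t : 0 <= s <= 1 -> 0 <= t <= 1 ->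
  (1 - alpha s < 1 - alpha t) = (s < t).
Proof. by move=> hs ht; rewrite -(schedule_lt halpha hs ht) ltrD2l ltrN2. Qed.

Lemma masking_le s t : 0 <= s <= 1 -> 0 <= t <= 1 ->
  (1 - alpha s <= 1 - alpha t) = (s <= t).
Proof. by move=> hs ht; rewrite !leNgt masking_lt. Qed.

End NextTimeLaw.

(** * Unmasking at a prescribed time has probability zero *)

Section NullJump.
Context (R : realType) (d : measure_display) (T : measurableType d) (L : nat).
Context (P : probability T R) (alpha : R -> R) (M : R -> T -> {set 'I_L}).
Hypothesis halpha : noise_schedule alpha.
Hypothesis hM : reverse_masking_process P alpha M.
Implicit Types (s t c : R) (w : T) (k n j m : nat).

Let tau := unmasking_time M.

Lemma measurable_card_le t k : 0 <= t <= 1 ->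
  measurable [set w | (#|M t w| <= k)%N].
Proof. exact: (measurable_masked hM (fun A => #|A| <= k)%N). Qed.

Lemma measurable_card_ge t k : 0 <= t <= 1 ->
  measurable [set w | (k <= #|M t w|)%N].
Proof. exact: (measurable_masked hM (fun A => k <= #|A|)%N). Qed.

Lemma measurable_unmasking_le k t : measurable [set w | tau k w <= t].
Proof.
rewrite (_ : [set _ | _] = tau k @^-1` `]-oo, t]).
  exact: (measurable_unmasking_set hM).
by apply/seteqP; split => w /=; rewrite in_itv.
Qed.

(* The paths of [M] are not assumed to be one-sided continuous, so the two
   events are compatible when the jump happens exactly at time [t]. *)
Lemma pr_unmasking_late k t : 0 < t <= 1 -> (k < L)%N ->
  pr P ([set w | tau k w <= t] `&` [set w | (#|M t w| <= k)%N]) = 0.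
Proof.
move=> /[dup] ht01 /andP[t0 t1] kL; have ht : 0 <= t <= 1 by rewrite ltW.
set E := _ `&` _.
have mE : measurable E.
  apply: measurableI; first exact: measurable_unmasking_le.
  exact: measurable_card_le.
move: t1; rewrite le_eqVlt => /predU1P[t1|t1].
  rewrite (_ : E = set0) ?pr0//; apply/seteqP; split => w //= [_ /=].
  by rewrite t1 (masked_card1 hM) leqNgt kL.
set F := 1 - alpha t; have F0 : 0 < F by exact: masking_gt0.
have F1 : F < 1.
  have h1 : 0 <= (1 : R) <= 1 by rewrite ler01 lexx.
  by have := masking_lt halpha ht h1; rewrite t1 (schedule1 halpha) subr0.
apply/eqP; rewrite eq_le pr_ge0 andbT.
set K : R := (#|{set 'I_L}| * #|{set 'I_L}|)%:R.
apply: (@le0_of_le_harmonic _ _ (K * ((1 - F) / F))) => m.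
(* A time [r > t] is chosen where the masking probability is [F + h]. On [E] more than [k] positions
   are masked at [r] and at most [k] at [t], so one is lost in between, with probability at most a
   constant times [h / (F + h) <= h / F]. *)
pose h := (1 - F) / m.+1%:R.
have h0 : 0 < h by rewrite divr_gt0// subr_gt0.
have hF : h <= 1 - F.
  by rewrite ler_pdivrMr// ler_peMr ?ler1n// subr_ge0 ltW.
have hx : 0 <= F + h <= 1 by lra.
have [r hr Fr] := schedule_surj_masking halpha hx.
have tr : t < r by rewrite -(masking_lt halpha ht hr) Fr -/F; lra.
have := pr_card_jump halpha hM k 1 (ltW t0) tr; case/andP: (hr) => _ r1 /(_ r1).
rewrite expr1 Fr -/F -/K => jump.
apply: (@le_trans _ _
    (pr P [set w | (k + 1 <= #|M r w|)%N && (#|M t w| <= k)%N])).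
  apply: le_pr => //.
    rewrite (_ : [set _ | _] = [set w | (k + 1 <= #|M r w|)%N] `&`
        [set w | (#|M t w| <= k)%N]).
      apply: measurableI; first exact: measurable_card_ge.
      exact: measurable_card_le.
    by apply/seteqP; split => w /= /andP.
  move=> w [/= wt ->]; rewrite andbT addn1 ltnNge; apply/negP => rk.
  by have := le_trans (le_unmasking_time kL hr rk) wt; rewrite leNgt tr.
apply: (le_trans jump); rewrite -mulrA ler_wpM2l ?ler0n//.
have Fh0 : 0 < F + h by lra.
rewrite -[X in 1 - X]mulr1 mulrAC -/h ler_pdivlMr//.
rewrite -[X in X - _](divff (lt0r_neq0 Fh0)).
rewrite mulr1 -mulrBl [X in X / _]addrAC subrr add0r mulrAC ler_pdivrMr//.
by rewrite ler_wpM2l ?lerDl// ltW.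
Qed.

End NullJump.

(** * The conditional distribution function of the next unmasking time *)

Section NextUnmasking.
Context (R : realType) (d : measure_display) (T : measurableType d) (L : nat).
Context (P : probability T R) (alpha : R -> R) (M : R -> T -> {set 'I_L}).
Hypothesis halpha : noise_schedule alpha.
Hypothesis hM : reverse_masking_process P alpha M.
Context (n : nat) (s : R).
Hypotheses (n0 : (0 < n)%N) (s0 : 0 < s) (s1 : s < 1).
Implicit Types (t a b : R) (w : T) (A H : set T).

Let F t := 1 - alpha t.
Let tau := unmasking_time M n.
Let X w := next_time_cdf alpha n s (tau w).
(** Up to a null event this says that the unmasking time of index [n.-1] is at most [s], but it
    involves a single time and so suits the Markov property. *)
Let survive := [set w | (n <= #|M s w|)%N].

(** Half-open cells, so that consecutive ones are disjoint and fit together exactly. *)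
Let between a b H := H `&` [set w | tau w <= b] `&` [set w | a < tau w].

Let hs : 0 <= s <= 1. Proof. by rewrite !ltW. Qed.

Let Fs_gt0 : 0 < F s. Proof. by apply: masking_gt0 => //; rewrite s0 ltW. Qed.

Lemma next_time_cdf_tau_itv w : 0 <= X w <= 1.
Proof. exact: (next_time_cdf_itv n halpha hs (unmasking_time_itv M n w)). Qed.

Lemma measurable_next_time_cdf_tau : measurable_fun setT X.
Proof.
rewrite (_ : X = (fun t => next_time_cdf alpha n s (clip t)) \o tau).
  apply: measurableT_comp; first exact: measurable_next_time_cdf.
  exact: (measurable_unmasking_time hM).
by apply/funext => w /=; rewrite clip_id//; exact: unmasking_time_itv.
Qed.

Let X01 := next_time_cdf_tau_itv.
Let mX := measurable_next_time_cdf_tau.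

Let msurvive : measurable survive.
Proof. exact: (measurable_card_ge hM). Qed.

Let mtau_le t : measurable [set w | tau w <= t].
Proof. exact: (measurable_unmasking_le hM). Qed.

Let tau_gtE t : [set w | t < tau w] = ~` [set w | tau w <= t].
Proof. by apply/seteqP; split => w /=; rewrite ltNge => /negP. Qed.

Let mtau_gt t : measurable [set w | t < tau w].
Proof. by rewrite tau_gtE; exact: measurableC. Qed.

(** Here the distribution function is 1. Survival fails only with fewer than [n] masked positions at
    [s], which is a null event when the count has not reached [n] above [s]. *)
Lemma survival_late H : (n < L)%N -> measurable H ->
  pr P (H `&` [set w | tau w <= s] `&` survive) =
  \int[P]_(w in H `&` [set w | tau w <= s]) X w.
Proof.
move=> nL mH; set A := _ `&` [set w | tau w <= s].
have mA : measurable A by exact: measurableI.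
have XA w : A w -> X w = 1 by case=> _ /= ts; rewrite /X /next_time_cdf ts.
have -> : \int[P]_(w in A) X w = pr P A.
  apply/eqP; rewrite eq_le -[X in _ <= X]mul1r -[X in _ && (X <= _)]mul1r.
  rewrite le_Rintegral_cst ?ge_Rintegral_cst// => w /XA ->//.
rewrite (pr_split P mA msurvive) [X in _ + X](_ : _ = 0) ?addr0//.
have ms : measurable [set w | (#|M s w| <= n)%N].
  exact: (measurable_card_le hM).
have hs' : 0 < s <= 1 by rewrite s0 ltW.
apply: (pr_null _ _ _ (pr_unmasking_late halpha hM hs' nL)) => //.
- by apply: measurableI => //; exact: measurableC.
- exact: measurableI.
- by move=> w [[_ ts] /= /negP]; rewrite -ltnNge => /ltnW.
Qed.

(** The cell event lies in the history at [a], so survival from exactly [n] masked positions at [a]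
    has factor [(F s / F a) ^+ n]. On the cell [F (tau w)] is between [F a] and [F b], which pins
    the integrand. What remains, fewer than [n] masked at [a], is up to a null event a double
    unmasking inside the cell. *)
Lemma survival_between a b H : s <= a -> a < b -> b <= 1 -> (n < L)%N ->
  unmasking_history M n H ->
  (F a / F b) ^+ n * pr P (between a b H `&` survive) <=
  \int[P]_(w in between a b H) X w <=
  pr P (between a b H `&` survive) +
    (#|{set 'I_L}| * #|{set 'I_L}|)%:R * (1 - F a / F b) ^+ 2.
Proof.
move=> sa ab b1 nL HH; rewrite /between; set A := _ `&` [set w | a < tau w].
have a0 : 0 < a by exact: lt_le_trans sa.
have ha : 0 <= a <= 1 by lra.
have /andP[_ a1] := ha.
have hb : 0 <= b <= 1 by lra.
have Fa0 : 0 < F a by apply: masking_gt0 => //; lra.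
have Fb0 : 0 < F b by apply: masking_gt0 => //; lra.
have Fsa : F s <= F a by rewrite /F masking_le.
have Fab : F a <= F b by rewrite /F masking_le// ltW.
have HA : history M a A.
  apply: (unmasking_historyI hM nL (ltW a0)); apply: generatedI => //.
  apply: sub_sigma_algebra; exists n, `]-oo, b]%classic; split => //.
    by rewrite leqnn ltnW.
have mA : measurable A by exact: (history_measurable hM (ltW a0)).
have cardA w : A w -> (#|M a w| <= n)%N.
  by case=> _ /= aw; apply: (lt_unmasking_time hM nL (ltW a0)).
pose full := [set w | #|M a w| = n].
have mfull : measurable full.
  rewrite (_ : full = [set w | #|M a w| == n]).
    exact: (measurable_masked hM (fun B : {set _} => #|B| == n)).
  by apply/seteqP; split => w /eqP.
pose c := (F s / F a) ^+ n.
have c01 : 0 <= c <= 1.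
  have r0 : 0 <= F s / F a by rewrite divr_ge0 ?(ltW Fs_gt0) ?(ltW Fa0).
  have r1 : F s / F a <= 1 by rewrite ler_pdivrMr// mul1r.
  by apply/andP; split; [exact: exprn_ge0|exact: exprn_ile1].
have rhoE : pr P (A `&` survive) = c * pr P (A `&` full).
  (* At most [n] positions are masked at [a] and at least [n] at [s <= a], so both counts are
     [n]. *)
  have -> : A `&` survive = A `&` full `&` [set w | #|M s w| = n].
    apply/seteqP; split => w; last first.
      by move=> [[Aw _] /= sn]; split; rewrite // /survive /= sn.
    move=> [Aw /= ns]; have := cardA w Aw => an.
    have sa' : (#|M s w| <= #|M a w|)%N.
      exact: (masked_card hM w (ltW s0) sa a1).
    split; first split=> //; apply/eqP; rewrite eqn_leq.
      by rewrite an (leq_trans ns).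
    by rewrite ns (leq_trans sa').
  have := sa; rewrite le_eqVlt => /predU1P[sa'|sa'].
    by rewrite /c /full sa' divff ?gt_eqF// expr1n mul1r -setIA setIid.
  exact: (pr_card_stay hM n (ltW s0) sa' a1 HA).
have XA w : A w -> (F a / F b) ^+ n * c <= X w <= c.
  move=> [[_ /= wb] aw].
  have ts : (tau w <= s) = false.
    by apply/negbTE; rewrite -ltNge (le_lt_trans sa).
  rewrite /X /next_time_cdf ts.
  have hw : 0 <= tau w <= 1 by exact: unmasking_time_itv.
  have Faw : F a <= F (tau w) by rewrite /F masking_le// ltW.
  have Fwb : F (tau w) <= F b by rewrite /F masking_le.
  have Fw0 : 0 < F (tau w) by lra.
  have r0 x : 0 < F x -> 0 <= F s / F x.
    by move=> Fx; rewrite divr_ge0 ?(ltW Fs_gt0) ?(ltW Fx).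
  rewrite -exprMn (_ : F a / F b * (F s / F a) = F s / F b); last first.
    by rewrite mulrC mulf_div [X in X / _]mulrC -mulf_div divff ?gt_eqF// mul1r.
  rewrite !lerXn2r ?nnegrE ?r0//.
    by rewrite ler_wpM2l ?(ltW Fs_gt0)// lef_pV2.
  by rewrite ler_wpM2l ?(ltW Fs_gt0)// lef_pV2.
have q0 : 0 <= F a / F b by rewrite divr_ge0 ?(ltW Fa0) ?(ltW Fb0).
have le_full : pr P (A `&` full) <= pr P A.
  by apply: le_pr => //; exact: measurableI.
apply/andP; split.
  rewrite rhoE mulrA; apply: (@le_trans _ _ ((F a / F b) ^+ n * c * pr P A)).
    apply: ler_wpM2l le_full; apply: mulr_ge0; first exact: exprn_ge0.
    by case/andP: c01.
  by apply: ge_Rintegral_cst => // w /XA /andP[].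
apply: (@le_trans _ _ (c * pr P A)).
  by apply: le_Rintegral_cst => // w /XA /andP[].
rewrite (pr_split P mA mfull) mulrDr rhoE lerD2l.
set D := A `&` ~` full.
have mD : measurable D by apply: measurableI => //; exact: measurableC.
apply: (@le_trans _ _ (pr P D)).
  by rewrite ler_piMl ?pr_ge0//; case/andP: c01.
have mb : measurable [set w | (#|M b w| <= n)%N].
  exact: (measurable_card_le hM).
(* Having at most [n] masked positions at [b] although [tau w <= b] is a null event. *)
rewrite (pr_split P mD mb) [X in X + _](_ : _ = 0) ?add0r; last first.
  have hb' : 0 < b <= 1 by rewrite b1 andbT; lra.
  apply: (pr_null _ _ _ (pr_unmasking_late halpha hM hb' nL)) => //.
  - exact: measurableI.
  - exact: measurableI.
  - by move=> w [[[[_ wb] _] _] bn].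
(* At least [n.-1 + 2] positions are masked at [b] and at most [n.-1] at [a]: two tokens are lost
   within the cell. *)
apply: le_trans (pr_card_jump halpha hM n.-1 2 (ltW a0) ab b1).
apply: le_pr.
- by apply: measurableI => //; exact: measurableC.
- rewrite (_ : [set _ | _] = [set w | (n.-1 + 2 <= #|M b w|)%N] `&`
      [set w | (#|M a w| <= n.-1)%N]).
    apply: measurableI; first exact: (measurable_card_ge hM).
    exact: (measurable_card_le hM).
  by apply/seteqP; split => w /= /andP.
- move=> w [[Aw /eqP na] /= /negP]; rewrite -ltnNge => nb.
  rewrite addn2 prednK// nb /= -ltnS prednK// ltn_neqAle na.
  exact: cardA.
Qed.


Let K : R := (#|{set 'I_L}| * #|{set 'I_L}|)%:R.

(** The cells are equal in the scale of [F], not in time: [F] grows by [h] from each grid point to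
    the next. *)
Let grid (h : R) (i : nat) := schedule_inv alpha (1 - (F s + i%:R * h)).

Let Fs_lt1 : F s < 1.
Proof.
have h1 : 0 <= (1 : R) <= 1 by rewrite ler01 lexx.
by have := masking_lt halpha hs h1; rewrite s1 (schedule1 halpha) subr0.
Qed.

(** The cell estimates are summed by induction on the number of cells. On each cell
    [1 - F a / F b = h / F b <= h / F s], a bound common to all cells, and Bernoulli's inequality
    replaces the [n]-th power by a linear factor. *)
Lemma survival_upto m i H : (n < L)%N -> unmasking_history M n H ->
  let h := (1 - F s) / m.+1%:R in (i <= m.+1)%N ->
  (1 - n%:R * (h / F s)) * pr P (between s (grid h i) H `&` survive) <=
  \int[P]_(w in between s (grid h i) H) X w /\
  \int[P]_(w in between s (grid h i) H) X w <=
  pr P (between s (grid h i) H `&` survive) + i%:R * (K * (h / F s) ^+ 2).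
Proof.
move=> nL HH h; have mH := unmasking_history_measurable hM HH.
have Fs0 := Fs_gt0; have Fs1 := Fs_lt1.
have h0 : 0 < h by rewrite divr_gt0// subr_gt0.
have gridE j : (j <= m.+1)%N ->
    0 <= grid h j <= 1 /\ F (grid h j) = F s + j%:R * h.
  move=> jm; have jh : 0 <= j%:R * h by rewrite mulr_ge0// ltW.
  have jh1 : j%:R * h <= 1 - F s.
    rewrite /h mulrCA -[leRHS]mulr1 ler_wpM2l ?subr_ge0 ?(ltW Fs1)//.
    by rewrite ler_pdivrMr// mul1r ler_nat.
  have hx : 0 <= 1 - (F s + j%:R * h) <= 1 by apply/andP; split; lra.
  have [? E] := schedule_invKd halpha hx; split => //.
  by rewrite [LHS]/F E opprB addrCA subrr addr0.
have mbtw a b : measurable (between a b H).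
  by rewrite /between; apply: measurableI => //; exact: measurableI.
have hFs0 : 0 <= h / F s by rewrite divr_ge0 ?(ltW h0) ?(ltW Fs0).
elim: i => [_|i IHi im].
  have -> : grid h 0 = s.
    have [h0' E] := gridE 0%N isT; move: E; rewrite mul0r addr0 => E.
    apply/eqP; rewrite eq_le -(masking_le halpha h0' hs).
    by rewrite -(masking_le halpha hs h0') -!/(F _) E lexx.
  have -> : between s s H = set0.
    apply/seteqP; split => w //= [[_ /=] ws] sw.
    by move: (lt_le_trans sw ws); rewrite ltxx.
  by rewrite set0I pr0 Rintegral_set0 mulr0 mul0r addr0.
have [ha Fa] := gridE i (ltnW im); have [hb Fb] := gridE _ im.
have [lo up] := IHi (ltnW im).
set a := grid h i in ha Fa lo up *; set b := grid h i.+1 in hb Fb *.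
have i0 : 0 <= i%:R * h by rewrite mulr_ge0// ltW.
have FbE : F b = F a + h by rewrite Fa Fb -natr1; ring.
have sa : s <= a by rewrite -(masking_le halpha hs ha) -!/(F _) Fa lerDl.
have ab : a < b by rewrite -(masking_lt halpha ha hb) -!/(F _) FbE ltrDl.
have /andP[_ b1] := hb.
have /andP[] := survival_between sa ab b1 nL HH; rewrite -/K => lo' up'.
have FaFs : F s <= F a by rewrite Fa lerDl.
have Fb0 : 0 < F b by rewrite FbE; lra.
have qE : 1 - F a / F b = h / F b.
  rewrite -[X in X - _](divff (lt0r_neq0 Fb0)) -mulrBl FbE.
  by rewrite addrAC subrr add0r.
have q1 : 1 - F a / F b <= h / F s.
  by rewrite qE ler_wpM2l ?(ltW h0)// lef_pV2 ?posrE// FbE; lra.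
have q0 : 0 <= 1 - F a / F b by rewrite qE divr_ge0 ?(ltW h0) ?(ltW Fb0).
have qn : 1 - n%:R * (h / F s) <= (F a / F b) ^+ n.
  have q2 : 1 - F a / F b <= 1.
    by rewrite gerBl divr_ge0 ?(ltW Fb0)// (le_trans (ltW Fs0)).
  have := bernoulli_ge n q2; rewrite opprB addrCA subrr addr0; apply: le_trans.
  by rewrite lerD2l lerN2 ler_wpM2l.
have q22 : K * (1 - F a / F b) ^+ 2 <= K * (h / F s) ^+ 2.
  by rewrite ler_wpM2l ?ler0n// lerXn2r ?nnegrE.
have split1 : between s b H `&` [set w | tau w <= a] = between s a H.
  apply/seteqP; split => w /=; first by move=> [[[Hw _] sw] wa].
  by move=> [[Hw wa] sw]; do !split => //=; rewrite (le_trans wa)// ltW.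
have split2 : between s b H `&` ~` [set w | tau w <= a] = between a b H.
  rewrite -tau_gtE; apply/seteqP; split => w /=.
    by move=> [[[Hw wb] _] aw].
  by move=> [[Hw wb] aw]; do !split => //=; rewrite (le_lt_trans sa).
rewrite (Rintegral_split P (mbtw s b) (mtau_le a) mX X01) split1 split2.
have -> : pr P (between s b H `&` survive) =
    pr P (between s a H `&` survive) + pr P (between a b H `&` survive).
  rewrite (pr_split P (measurableI _ _ (mbtw s b) msurvive) (mtau_le a)).
  by rewrite ![between s b H `&` survive `&` _]setIAC split1 split2.
have r0 := pr_ge0 P (between a b H `&` survive).
have lo'' := ler_wpM2r r0 qn; split.
  by rewrite mulrDr; apply: lerD => //; exact: le_trans lo'.
rewrite -natr1 mulrDl mul1r addrACA; apply: lerD => //.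
by apply: (le_trans up'); rewrite lerD2l.
Qed.

(** The mesh tends to 0. The lower estimate loses a factor [1 - O(1/m)], the upper one adds [m.+1]
    errors of order [1/m^2]; both differences are therefore bounded by a constant over [m.+1]. *)
Lemma survival_early H : (n < L)%N -> unmasking_history M n H ->
  pr P (H `&` [set w | s < tau w] `&` survive) =
  \int[P]_(w in H `&` [set w | s < tau w]) X w.
Proof.
move=> nL HH; have Fs0 := Fs_gt0; have Fs1 := Fs_lt1.
have mH : measurable H by exact: (unmasking_history_measurable hM HH).
set A := _ `&` [set w | s < tau w]; set rho := pr P _; set I := Rintegral _ _ _.
have bounds m : let h := (1 - F s) / m.+1%:R in
    (1 - n%:R * (h / F s)) * rho <= I /\
    I <= rho + m.+1%:R * (K * (h / F s) ^+ 2).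
  move=> h; have := survival_upto nL HH (leqnn m.+1); rewrite -/h.
  have -> : between s (grid h m.+1) H = A => //.
  (* The step [h] is chosen so that [m.+1] steps lead from [F s] to 1, the value of [F] at time
     1. *)
  have -> : grid h m.+1 = 1.
    rewrite /grid /h mulrC divfK ?pnatr_eq0// addrCA subrr addr0 subrr.
    by rewrite -(schedule1 halpha) schedule_invK// ler01 lexx.
  apply/seteqP; split => w /=; first by move=> [[Hw _] sw].
  move=> [Hw sw]; do !split => //=.
  by case/andP: (unmasking_time_itv M n w).
have mA : measurable A by exact: measurableI.
have rho0 : 0 <= rho by exact: pr_ge0.
have rho1 : rho <= 1 by apply: pr_le1; exact: measurableI.
apply/eqP; rewrite eq_le -[rho <= I]subr_le0 -[I <= rho]subr_le0.
apply/andP; split.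
  apply: (@le0_of_le_harmonic _ _ (n%:R * ((1 - F s) / F s))) => m.
  have [+ _] := bounds m.
  rewrite mulrBl mul1r lerBlDr -lerBlDl => /le_trans; apply.
  apply: (@le_trans _ _ (n%:R * ((1 - F s) / m.+1%:R / F s) * 1)).
    rewrite ler_wpM2l// mulr_ge0// divr_ge0 ?(ltW Fs0)// divr_ge0//.
    by rewrite subr_ge0 ltW.
  by rewrite mulr1 -[leRHS]mulrA [X in _ <= _ * X]mulrAC.
apply: (@le0_of_le_harmonic _ _ (K * ((1 - F s) / F s) ^+ 2)) => m.
have [_] := bounds m; rewrite -lerBlDl => /le_trans; apply.
rewrite le_eqVlt; apply/orP; left; apply/eqP.
have m0 : m.+1%:R != 0 :> R by rewrite pnatr_eq0.
by field; rewrite nat1r m0 lt0r_neq0.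
Qed.

Lemma survival H : (n <= L)%N -> unmasking_history M n H ->
  pr P (H `&` survive) = \int[P]_(w in H) X w.
Proof.
move=> + HH; have mH := unmasking_history_measurable hM HH.
rewrite leq_eqVlt => /predU1P[nL|nL]; last first.
  have mHs : measurable (H `&` survive) by exact: measurableI.
  rewrite (Rintegral_split P mH (mtau_le s) mX X01).
  rewrite (pr_split P mHs (mtau_le s)).
  rewrite -tau_gtE ![H `&` survive `&` _]setIAC.
  by rewrite survival_late// survival_early.
have tau1 w : tau w = 1 by rewrite /tau nL unmasking_time_full.
(* For [n = L] the only generating variable is the constant 1, so [H] belongs to the history at time
   1 and a single Markov step from 1 to [s] suffices. *)
have H1 : history M 1 H.
  rewrite -[H]setIT; apply: generated_trace HH; first exact: generatedT.
  move=> _ [k [B [/andP[nk kL] mB ->]]].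
  have -> : k = L by apply/eqP; rewrite eqn_leq kL -{1}nL.
  rewrite unmasking_time_full setIT preimage_cst.
  by case: ifP => _; [exact: generatedT|exact: sigma_algebra0].
have -> : \int[P]_(w in H) X w = ((1 - alpha s) / (1 - alpha 1)) ^+ n * pr P H.
  rewrite -Rintegral_cst//; congr fine; apply: eq_integral => w _.
  by rewrite /X /next_time_cdf tau1 leNgt s1.
have full : H `&` [set w | #|M 1 w| = n] = H.
  apply/seteqP; split => w; first by case.
  by move=> Hw; split=> //=; rewrite (masked_card1 hM) nL.
have := pr_card_stay hM n (ltW s0) s1 (lexx 1) H1; rewrite full => <-.
congr (pr P (_ `&` _)); apply/seteqP; split => w; rewrite /survive /=.
  move=> ns; apply/eqP; rewrite eqn_leq ns andbT nL.
  by rewrite -[X in (_ <= X)%N](card_ord L) max_card.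
by move=> ->.
Qed.

Lemma pr_next_unmasking_le H : (n <= L)%N -> unmasking_history M n H ->
  pr P (H `&` [set w | unmasking_time M n.-1 w <= s]) = \int[P]_(w in H) X w.
Proof.
move=> nL HH; rewrite -survival//.
have mH : measurable H by exact: (unmasking_history_measurable hM HH).
have n1L : (n.-1 < L)%N by rewrite prednK.
set E := [set w | _ <= s].
have mE : measurable E by exact: (measurable_unmasking_le hM).
have mHE : measurable (H `&` E) by exact: measurableI.
rewrite (pr_split P mHE msurvive) [X in _ + X](_ : _ = 0) ?addr0.
  congr (pr P _); apply/seteqP; split => w; first by move=> [[]].
  move=> [Hw ns]; do !split => //; rewrite /E /= leNgt; apply/negP => sw.
  have := lt_unmasking_time hM n1L (ltW s0) sw.
  by rewrite -ltnS prednK// ltnNge ns.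
have hs' : 0 < s <= 1 by rewrite s0 ltW.
apply: (pr_null _ _ _ (pr_unmasking_late halpha hM hs' n1L)) => //.
- by apply: measurableI => //; exact: measurableC.
- by apply: measurableI => //; exact: (measurable_card_le hM).
- move=> w [[_ ws] /= /negP]; rewrite -ltnNge => ns; split=> //=.
  by rewrite -ltnS prednK.
Qed.

End NextUnmasking.

(** * Conditional laws *)

Section UnitIntervalMeasures.
Local Open Scope ereal_scope.
Context (R : realType).
Variables m1 m2 : {measure set R -> \bar R}.
Hypotheses (m1m2 : m1 setT = m2 setT) (m1oo : m1 setT < +oo).
Hypothesis m1_out : m1 (~` `[0%R, 1%R]) = 0.
Hypothesis m2_out : m2 (~` `[0%R, 1%R]) = 0.
Hypothesis m1m2_le : forall s : R, (0 < s < 1)%R ->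
  m1 `]-oo, s]%classic = m2 `]-oo, s]%classic.

Let m2oo : m2 setT < +oo. Proof. by rewrite -m1m2. Qed.

Let null (m : {measure set R -> \bar R}) (A : set R) :
  measurable A -> m (~` `[0%R, 1%R]) = 0 -> A `<=` ~` `[0%R, 1%R] -> m A = 0.
Proof.
move=> mA m0 A01; apply: (subset_measure0 mA _ A01 m0).
by apply: measurableC; exact: measurable_itv.
Qed.

Let tailE (m : {measure set R -> \bar R}) (s : R) : m setT < +oo ->
  m `]s, +oo[%classic = m setT - m `]-oo, s]%classic.
Proof.
move=> moo; rewrite -setCitvl -setTD measureD//= ?setTI//.
Qed.

Let tail_pos s : (0 < s)%R -> m1 `]s, +oo[%classic = m2 `]s, +oo[%classic.
Proof.
move=> s0; have [s1|s1] := ltP s 1%R.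
  by rewrite !tailE// m1m2 m1m2_le// s0.
have out : `]s, +oo[%classic `<=` ~` `[0%R, 1%R].
  move=> r /=; rewrite !in_itv/= andbT => sr; apply/negP.
  by rewrite negb_and -!ltNge (le_lt_trans s1)// orbT.
by rewrite (null _ m1_out out)// (null _ m2_out out).
Qed.

(** Open upper rays generate the Borel sets and are stable under intersection, so agreement on them
    is enough. Outside [0, 1] both measures vanish. *)
Lemma eq_measure_unit_interval A : measurable A -> m1 A = m2 A.
Proof.
move=> mA; apply: (measure_unique (@RGenOInfty.G R)
  (fun k => `](- k%:R)%R, +oo[%classic)) => //.
- exact: RGenOInfty.measurableE.
- move=> _ _ [x ->] [y ->]; exists (Order.max x y).
  by apply/seteqP; split => r /=; rewrite !in_itv/= !andbT gt_max => /andP.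
- by move=> k; exists (- k%:R)%R.
- apply/seteqP; split => // r _; exists (Num.bound `|r|) => //=.
  rewrite in_itv/= andbT ltrNl (le_lt_trans (ler_norm _))// normrN.
  by rewrite archi_boundP.
- move=> _ [s ->]; have [s0|s0|->] := ltgtP s 0%R.
  + have out : `]-oo, s]%classic `<=` ~` `[0%R, 1%R].
      move=> r /=; rewrite !in_itv/= => rs; apply/negP.
      by rewrite negb_and -!ltNge (le_lt_trans rs).
    by rewrite !tailE// m1m2 (null _ m1_out out)// (null _ m2_out out).
  + exact: tail_pos.
  (* The hypothesis concerns only [0 < s < 1]; the ray above 0 is reached as an increasing union of
     rays above positive points. *)
  + pose B (k : nat) : set R := `](k.+1%:R^-1)%R, +oo[%classic.
    have BE : \bigcup_k B k = `]0%R, +oo[%classic.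
      apply/seteqP; split => r /=.
        move=> [k _]; rewrite /B/= !in_itv/= !andbT.
        by apply: lt_trans; rewrite invr_gt0.
      rewrite in_itv/= andbT => r0.
      exists (Num.bound (r^-1)%R) => //=; rewrite /B/= in_itv/= andbT.
      rewrite invf_plt ?posrE// (lt_trans (archi_boundP _)) ?ltr_nat//.
      by rewrite invr_ge0 ltW.
    have ndB : {homo B : n m / (n <= m)%N >-> (n <= m)%O}.
      move=> i j ij; apply/subsetPset => r /=; rewrite /B/= !in_itv/= !andbT.
      by apply: le_lt_trans; rewrite lef_pV2 ?posrE// ler_nat.
    have cvgB (m : {measure set R -> \bar R}) :
        m (B k) @[k --> \oo] --> m `]0%R, +oo[%classic.
      rewrite -BE; apply: (@nondecreasing_cvg_mu _ _ _ m B) => //.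
        by move=> k; exact: measurable_itv.
      by apply: bigcupT_measurable => k; exact: measurable_itv.
    have := cvgB m1; under eq_fun do rewrite tail_pos ?invr_gt0//.
    by move=> /(cvg_unique (@ereal_hausdorff R)); apply; exact: cvgB.
- by move=> k; apply: le_lt_trans m1oo; rewrite le_measure// inE.
Qed.

End UnitIntervalMeasures.

(** * Product measures and joint laws *)

Section NextTimeProduct.
Context (R : realType) (d : measure_display) (S : measurableType d).
Context (Q : probability S R) (alpha : R -> R) (n : nat) (tau : S -> R).
Hypotheses (halpha : noise_schedule alpha) (mtau : measurable_fun setT tau).
Hypothesis tau01 : forall w, 0 <= tau w <= 1.
Local Notation U := (uniform_prob (@ltr01 R)).

Lemma measurable_next_time_tau :
  measurable_fun setT (fun z : S * R => next_time alpha n (tau z.1) z.2).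
Proof.
rewrite (_ : (fun _ => _) =
    (fun z : R * R => next_time alpha n (clip z.1) z.2) \o
    (fun z : S * R => (tau z.1, z.2))).
  apply: measurableT_comp; first exact: measurable_next_time.
  apply: measurable_fun_pair => //; exact: measurableT_comp.
by apply/funext => z /=; rewrite clip_id.
Qed.

Lemma measurable_next_time_set H (B : set R) : measurable H -> measurable B ->
  measurable [set z : S * R | H z.1 /\ B (next_time alpha n (tau z.1) z.2)].
Proof.
move=> mH mB; rewrite (_ : [set _ | _] = (H `*` setT) `&`
    (fun z : S * R => next_time alpha n (tau z.1) z.2) @^-1` B).
  apply: measurableI; first exact: measurableX.
  by rewrite -[X in measurable X]setTI; exact: measurable_next_time_tau.
by apply/seteqP; split => -[w v] /= => [[]|[[]]].
Qed.

Lemma measurable_next_time_preimage t (B : set R) :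
  0 <= t <= 1 -> measurable B ->
  measurable (next_time alpha n t @^-1` B).
Proof.
move=> ht mB; rewrite -(clip_id ht) -[X in measurable X]setTI.
exact: measurable_next_time_clip.
Qed.

Lemma measurable_uniform_next_time_tau (B : set R) : measurable B ->
  measurable_fun setT (fun w => U (next_time alpha n (tau w) @^-1` B)).
Proof.
move=> mB; rewrite (_ : (fun _ => _) =
    (fun t => U (next_time alpha n (clip t) @^-1` B)) \o tau).
  by apply: measurableT_comp => //; exact: measurable_uniform_next_time.
by apply/funext => w /=; rewrite clip_id.
Qed.

(** The section at [w] is the preimage of [B] when [w] lies in [H] and empty otherwise, so the
    product measure integrates over [H] only. *)
Lemma product_next_time_set H (B : set R) : measurable H -> measurable B ->
  ((Q \x U) [set z : S * R | H z.1 /\ B (next_time alpha n (tau z.1) z.2)] =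
   \int[Q]_(w in H) U (next_time alpha n (tau w) @^-1` B))%E.
Proof.
move=> mH mB; rewrite /product_measure1 [RHS]integral_mkcond.
apply: eq_integral => w _ /=; rewrite patchE; case: ifPn => wH.
  congr (U _); apply/seteqP.
  split => v; rewrite /xsection /= inE; first by case.
  by move=> Bv; split => //; rewrite inE in wH.
rewrite (_ : xsection _ _ = set0) ?measure0//.
apply/seteqP; split => v //; rewrite /xsection /= inE /= => -[Hw _].
by move: wH; rewrite notin_setE.
Qed.

End NextTimeProduct.

Lemma restricted_image d1 d2 (T1 : measurableType d1) (T2 : measurableType d2)
    (R : realType) (m : {measure set T1 -> \bar R}) (f : T1 -> T2)
    (H : set T1) :
  measurable H -> measurable_fun setT f ->
  exists mu : {measure set T2 -> \bar R}, forall C, mu C = m (f @^-1` C `&` H).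
Proof.
move=> mH mf.
by exists (measure_function_pushforward__canonical__measure_function_Measure
  (mrestr m mH) mf).
Qed.

Lemma independent_joint_law (R : realType) d d1 d2 (T : measurableType d)
    (T1 : measurableType d1) (T2 : measurableType d2) (P : probability T R)
    (m1 : probability T1 R) (m2 : probability T2 R)
    (f : T -> T1) (g : T -> T2) :
  measurable_fun setT f -> measurable_fun setT g ->
  (forall A C, measurable A -> measurable C ->
     P (f @^-1` A `&` g @^-1` C) = (m1 A * m2 C)%E) ->
  forall S, measurable S -> P [set w | S (f w, g w)] = (m1 \x m2)%E S.
Proof.
move=> mf mg rect S mS.
have mfg : measurable_fun setT (fun w => (f w, g w)).
  exact: measurable_fun_pair.
pose fg : {mfun T >-> (T1 * T2)%type} := MeasurableFun.Pack
  (MeasurableFun.Class (isMeasurableFun.Build _ _ _ _ _ mfg)).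
by rewrite (@product_measure_unique _ _ _ _ _ m1 m2 (distribution P fg)).
Qed.

(** * Identification of the two conditional laws *)

Section Conclusion.
Context (R : realType) (d : measure_display) (T : measurableType d) (L : nat).
Context (P : probability T R) (alpha : R -> R) (M : R -> T -> {set 'I_L}).
Hypothesis halpha : noise_schedule alpha.
Hypothesis hM : reverse_masking_process P alpha M.
Context (n : nat) (hn : (1 <= n <= L)%N).
Local Notation U := (uniform_prob (@ltr01 R)).
Local Notation tau := (unmasking_time M n).
Local Notation G := (unmasking_history M n).

Let n0 : (0 < n)%N. Proof. by case/andP: hn. Qed.
Let nL : (n <= L)%N. Proof. by case/andP: hn. Qed.

Let tau01 w : 0 <= tau w <= 1. Proof. exact: unmasking_time_itv. Qed.

Let mtau : measurable_fun setT tau.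
Proof. exact: (measurable_unmasking_time hM). Qed.

(** The kernel depends on the outcome through [tau] alone, hence is measurable for the unmasking
    history; only the averaging identity is specific to [X]. *)
Lemma has_cond_law_next_time (X : T -> R) : measurable_fun setT X ->
  (forall H B, G H -> measurable B -> (P (H `&` X @^-1` B) =
     \int[P]_(w in H) U (next_time alpha n (tau w) @^-1` B))%E) ->
  has_cond_law P G X (fun w B => U (next_time alpha n (tau w) @^-1` B)).
Proof.
move=> mX XE B mB.
have finU w : U (next_time alpha n (tau w) @^-1` B) \is a fin_num.
  by rewrite fin_num_measure//; exact: measurable_next_time_preimage.
pose phi t := fine (U (next_time alpha n (clip t) @^-1` B)).
have mphi : measurable_fun setT phi.
  apply: measurableT_comp => //; exact: measurable_uniform_next_time.
have phiE :
    (fun w => fine (U (next_time alpha n (tau w) @^-1` B))) = phi \o tau.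
  by apply/funext => w; rewrite /phi /= clip_id.
split.
- move=> C mC; rewrite phiE; apply: sub_sigma_algebra.
  exists n, (phi @^-1` C); split => //; first by rewrite leqnn nL.
  by rewrite -[X in measurable X]setTI; exact: mphi.
- apply: integrable_itv => //; first by rewrite phiE; exact: measurableT_comp.
  move=> w; rewrite -!lee_fin fineK// measure_ge0 probability_le1//.
  exact: measurable_next_time_preimage.
- move=> H GH; rewrite XE//.
  by apply: eq_integral => w _; rewrite fineK.
Qed.

(** Both sides are finite measures in [B] carried by [0, 1], so the computed distribution functions
    at [0 < s < 1] identify them. *)
Lemma unmasking_time_law H (B : set R) : G H -> measurable B ->
  (P (H `&` unmasking_time M n.-1 @^-1` B) =
   \int[P]_(w in H) U (next_time alpha n (tau w) @^-1` B))%E.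
Proof.
move=> GH mB; have mH := unmasking_history_measurable hM GH.
have mg := measurable_next_time_tau n halpha mtau tau01.
have mt : measurable_fun setT (unmasking_time M n.-1).
  exact: (measurable_unmasking_time hM).
have mHT : measurable (H `*` [set: R]) by exact: measurableX.
have [m1 m1E] := restricted_image P mH mt.
have [m2 m2E] := restricted_image (P \x U)%E mHT mg.
have m2E' C : measurable C ->
    m2 C = (\int[P]_(w in H) U (next_time alpha n (tau w) @^-1` C))%E.
  move=> mC; rewrite m2E -(product_next_time_set P alpha n tau mH mC).
  by congr (_ _); apply/seteqP; split => -[w v] /= => [[? []]|[]].
have out01 (f : R -> R) :
    (forall v, 0 <= f v <= 1) -> f @^-1` (~` `[0, 1]) = set0.
  move=> f01; apply/seteqP; split => v //=; apply.
  by rewrite in_itv/=.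
rewrite setIC -m1E -m2E'//; apply: eq_measure_unit_interval => //.
- rewrite m1E m2E' // preimage_setT setTI.
  rewrite (eq_integral (cst 1%E)) ?integral_cst ?mul1e// => w _.
  by rewrite preimage_setT probability_setT.
- by rewrite m1E preimage_setT setTI (le_lt_trans (probability_le1 _ _))// ltry.
- rewrite m1E (_ : _ @^-1` _ = set0) ?set0I ?measure0//.
  apply/seteqP; split => w //=; apply; rewrite in_itv/=.
  exact: unmasking_time_itv.
- rewrite m2E'; last by apply: measurableC; exact: measurable_itv.
  rewrite (eq_integral (cst 0%E)) ?integral0// => w _.
  by rewrite out01 ?measure0// => v; exact: next_time_itv.
- move=> s /andP[s0 s1]; rewrite m1E m2E'//.
  have hs : 0 <= s <= 1 by rewrite !ltW.
  rewrite setIC.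
  rewrite (_ : _ @^-1` _ = [set w | unmasking_time M n.-1 w <= s]); last first.
    by apply/seteqP; split => w /=; rewrite in_itv.
  transitivity (pr P (H `&` [set w | unmasking_time M n.-1 w <= s]))%:E.
    apply: prE; apply: measurableI => //.
    exact: (measurable_unmasking_le hM).
  rewrite (pr_next_unmasking_le halpha hM n0 s0 s1 nL GH).
  rewrite EFin_Rintegral//.
  + by apply: eq_integral => w _; rewrite (uniform_next_time_le halpha n0 hs).
  + exact: (measurable_next_time_cdf_tau halpha hM n0 s0 s1).
  + exact: (next_time_cdf_tau_itv M halpha).
Qed.


Lemma next_time_law (u : {RV P >-> R}) H (B : set R) :
  (forall C : set R, measurable C -> distribution P u C = U C) ->
  indep_of P G u -> G H -> measurable B ->
  (P (H `&` (fun w => next_time alpha n (tau w) (u w)) @^-1` B) =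
   \int[P]_(w in H) U (next_time alpha n (tau w) @^-1` B))%E.
Proof.
move=> uU indep GH mB.
(* With [T] carrying the coarser sigma-algebra [G] as well, [id] and [u] are
   independent, so the pair has a product law. *)
pose gen := [set E | exists k (B : set R),
  [/\ (n <= k <= L)%N, measurable B & E = unmasking_time M k @^-1` B]].
pose TG : measurableType gen.-sigma := g_sigma_algebraType gen.
have mid : measurable_fun setT (id : T -> TG).
  by move=> _ A GA; rewrite setTI; exact: (unmasking_history_measurable hM GA).
have mtauG : measurable_fun setT (tau : TG -> R).
  move=> _ C mC; rewrite setTI; apply: sub_sigma_algebra.
  by exists n, C; rewrite leqnn nL.
pose idG : {mfun T >-> TG} := MeasurableFun.Pack
  (MeasurableFun.Class (isMeasurableFun.Build _ _ _ _ _ mid)).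
pose PG : probability TG R := distribution P idG.
have mHG : @measurable _ TG H by [].
pose S := [set z : TG * R | H z.1 /\ B (next_time alpha n (tau z.1) z.2)].
have mS : @measurable _ (TG * R)%type S.
  exact: (@measurable_next_time_set R _ TG alpha n tau halpha mtauG
    tau01 H B mHG mB).
transitivity ((PG \x U)%E S).
  apply: (@independent_joint_law R _ _ _ T TG (measurableTypeR R) P PG U
    id u mid _ _ S mS).
    exact: (@measurable_funPT _ _ _ _ u).
  move=> A C mA mC; have := indep A C mA mC.
  by rewrite -[P (u @^-1` C)]/(distribution P u C) uU.
rewrite (product_next_time_set PG alpha n tau mHG mB).
(* [PG] is the image of [P] under the identity into the coarser space, so the integral returns to
   [P]. *)
rewrite ge0_integral_pushforward//.
  apply: measurable_funTS.
  exact: measurable_uniform_next_time_tau.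
Qed.

Lemma cond_law_next_time (u : {RV P >-> R}) :
  (forall C : set R, measurable C -> distribution P u C = U C) ->
  indep_of P G u ->
  has_cond_law P G (fun w => next_time alpha n (tau w) (u w))
    (fun w B => U (next_time alpha n (tau w) @^-1` B)).
Proof.
move=> uU indep; apply: has_cond_law_next_time.
  apply: (measurableT_comp (measurable_next_time_tau n halpha mtau tau01)
    (g := fun w => (w, u w))).
  by apply: measurable_fun_pair => //; exact: measurable_funPT.
by move=> H B GH mB; exact: next_time_law.
Qed.

Lemma cond_law_unmasking_time :
  has_cond_law P G (unmasking_time M n.-1)
    (fun w B => U (next_time alpha n (tau w) @^-1` B)).
Proof.
apply: has_cond_law_next_time; first exact: (measurable_unmasking_time hM).
by move=> H B GH mB; exact: unmasking_time_law.
Qed.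

End Conclusion.

Theorem proposition4p1 (R : realType) (d : measure_display)
    (T : measurableType d) (P : probability T R)
    (alpha : R -> R) (halpha : noise_schedule alpha)
    (L : nat) (hL : (1 <= L)%N)
    (M : R -> T -> {set 'I_L}) (hM : reverse_masking_process P alpha M)
    (n : nat) (hn : (1 <= n <= L)%N) :
  (forall u : {RV P >-> R},
     (forall B : set R, measurable B ->
        distribution P u B = uniform_prob (@ltr01 R) B) ->
     indep_of P (unmasking_history M n) u ->
     same_cond_law P (unmasking_history M n)
       (unmasking_time M n.-1)
       (fun w => next_time alpha n (unmasking_time M n w) (u w)))
  /\
  has_cond_law P (unmasking_history M n)
    (unmasking_time M n.-1)
    (fun w B => uniform_prob (@ltr01 R)
       (next_time alpha n (unmasking_time M n w) @^-1` B)).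
Proof.
have law := cond_law_unmasking_time halpha hM hn.
split=> // u uU indep.
(* [same_cond_law] asks for a probability at every outcome. It is built as the law of [next_time]
   under the uniform measure, with a clipped time argument; clipping changes nothing since unmasking
   times lie in [0, 1]. *)
have mg t : @measurable_fun _ _ (measurableTypeR R) R setT
    (next_time alpha n (clip t)).
  exact: measurable_next_time_clip.
pose g t : {mfun measurableTypeR R >-> R} := MeasurableFun.Pack
  (MeasurableFun.Class (isMeasurableFun.Build _ _ _ _ _ (mg t))).
exists (fun w =>
  distribution (uniform_prob (@ltr01 R)) (g (unmasking_time M n w))).
rewrite (_ : (fun w => _ : set R -> \bar R) = fun w B => uniform_prob (@ltr01 R)
    (next_time alpha n (unmasking_time M n w) @^-1` B)).
  by split=> //; exact: cond_law_next_time.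
apply/funext => w; apply/funext => B.
by rewrite /distribution /pushforward /= clip_id//; exact: unmasking_time_itv.
Qed.
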